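(* Let $G$ be a finite group, $H=\mathbb{C}[G]$, and let $\mathcal{C}=\{t,x,y,z\}\subset G$ be a cyclic conjugacy class with $4$ elements, labelled so that the table of $\mathrm{Ad}$ given in the context holds. For the framing defined by the Maurer-Cartan 1-form, the moduli space of torsion free connections is $3|G|$-dimensional and is given by the following component 1-forms: $$\begin{aligned} A_t&=(1+\alpha)e_t+\gamma e_x+\lambda e_y+\beta e_z,\\ A_x&=\lambda e_t+(1+\beta)e_x+\alpha e_y+\gamma e_z,\\ A_y&=\beta e_t+\lambda e_x+(1+\gamma)e_y+\alpha e_z,\\ A_z&=\gamma e_t+\alpha e_x+\beta e_y+(1+\lambda)e_z, \end{aligned}$$ where $\alpha,\beta,\gamma,\lambda\in H$ are functions on $G$ such that $\alpha+\beta+\gamma+\lambda=-1$. Consequently, every torsion free connection also satisfies $\sum_{a\in\mathcal{C}}A_a=0$.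
   Context: Cyclic: a conjugacy class $\mathcal{C}$ with $n\ge 2$ elements in a group $G$ is called cyclic if there exists at least one $t\in\mathcal{C}$ such that $\mathrm{Ad}_t$ (where $\mathrm{Ad}_a(b)=aba^{-1}$) is a cyclic permutation of $\mathcal{C}-\{t\}$ (a single cycle on this set) and the map $a\mapsto \mathrm{Ad}_a(t)$ is a permutation of $\mathcal{C}$. For $n=4$ the elements can be labelled $t,x,y,z$ so that: $\mathrm{Ad}_t$: $t\mapsto t,\ x\mapsto z,\ y\mapsto x,\ z\mapsto y$; $\mathrm{Ad}_x$: $t\mapsto y,\ x\mapsto x,\ y\mapsto z,\ z\mapsto t$; $\mathrm{Ad}_y$: $t\mapsto z,\ x\mapsto t,\ y\mapsto y,\ z\mapsto x$; $\mathrm{Ad}_z$: $t\mapsto x,\ x\mapsto y,\ y\mapsto t,\ z\mapsto z$. Differential calculus: $H=\mathbb{C}[G]$ is the algebra of complex functions on $G$, and $(R_af)(g)=f(ga)$. $\Omega^1(H)$ is the free left $H$-module with basis $\{e_a\}_{a\in\mathcal{C}}$ (the Maurer-Cartan 1-forms, which are taken as the framing), with right module structure $e_af=R_a(f)e_a$, and $\mathrm{d}f=\sum_{a\in\mathcal{C}}(R_af-f)e_a$. Let $\Psi$ be the $H$-bimodule map on $\Omega^1(H)\otimes_H\Omega^1(H)$ with $\Psi(e_a\otimes_H e_b)=e_{aba^{-1}}\otimes_H e_a$. Then $\Omega^2(H)=(\Omega^1(H)\otimes_H\Omega^1(H))/\ker(\mathrm{id}-\Psi)$, with $\wedge$ the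 image in the quotient, and $\mathrm{d}e_a=\theta\wedge e_a+e_a\wedge\theta$, where $\theta=\sum_{a\in\mathcal{C}}e_a$. Connections: a (spin) connection is a collection $\{A_a\}_{a\in\mathcal{C}}$ of 1-forms $A_a\in\Omega^1(H)$. It is torsion free if $$\mathrm{d}e_a+\sum_{b\in\mathcal{C}}A_b\wedge(e_{b^{-1}ab}-e_a)=0\qquad\forall a\in\mathcal{C}.$$ *)

(* Defs.v *)
From HB Require Import structures.
From mathcomp Require Import all_boot all_order all_algebra all_fingroup.
From mathcomp Require Import generic_quotient ring_quotient.

Set Implicit Arguments.
Unset Strict Implicit.
Unset Printing Implicit Defensive.
Import GRing.Theory.
Local Open Scope ring_scope.

Definition affine_of_dim (K : fieldType) (V : vectType K) (P : V -> Prop)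
    (n : nat) : Prop :=
  exists v0 : V, exists U : {vspace V},
    \dim U = n /\ (forall v, P v <-> v - v0 \in U).

Section ConjugacyClass.
Variable gT : finGroupType.
Implicit Types (a b t : gT) (C : {set gT}).

(* The opposite of MathComp's convention: [b ^ a] is a^-1 * b * a. *)
Definition Ad a b : gT := (a * b * a^-1)%g.

Definition single_cycle_on (D : {set gT}) (f : gT -> gT) : Prop :=
  exists s : seq gT, ufcycle f s /\ s =i D.

Definition cyclic_class C : Prop :=
  [/\ C \in classes [set: gT], (2 <= #|C|)%N &
      exists t, [/\ t \in C, single_cycle_on (C :\ t) (Ad t),
                    {in C &, injective (Ad^~ t)} & Ad^~ t @: C = C]].

Record cls C := Cls { cls_val :> gT; clsP : cls_val \in C }.
HB.instance Definition _ C := [isSub for @cls_val C].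
HB.instance Definition _ C := [Finite of cls C by <:].

Definition Ad_table C (t x y z : cls C) : Prop :=
  [/\ [/\ Ad t t = t, Ad t x = z, Ad t y = x & Ad t z = y],
      [/\ Ad x t = y, Ad x x = x, Ad x y = z & Ad x z = t],
      [/\ Ad y t = z, Ad y x = t, Ad y y = y & Ad y z = x] &
      [/\ Ad z t = x, Ad z x = y, Ad z y = t & Ad z z = z]].

End ConjugacyClass.

(* K[G] with its pointwise product; [K^o] provides its K-vector space
   structure. *)
Notation funalg K gT := {ffun gT -> K^o}.

(* Omega^1 is free over K[G] on the e_a, a in C: a form is its family of
   coefficients. *)
Notation Om1 K gT C := {ffun @cls gT C -> funalg K gT}.

(* Omega^1 (x)_H Omega^1 for H = K[G], free over H on the e_a (x) e_b.  Lemmas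
   [tens_balanced] and [tens_universal] identify it, together with [tens], as
   the tensor product over H. *)
Notation Om11 K gT C := {ffun @cls gT C * @cls gT C -> funalg K gT}.

Section Calculus.
Variables (K : fieldType) (gT : finGroupType) (C : {set gT}).
Local Notation H := (funalg K gT).
Local Notation Om1 := (Om1 K gT C).
Local Notation Om11 := (Om11 K gT C).
Implicit Types (f h : H) (w v : Om1) (T S : Om11).

Definition Rtr (a : gT) f : H := [ffun g => f (g * a)%g].

Definition lact (J : finType) f (u : {ffun J -> H}) : {ffun J -> H} :=
  [ffun j => f * u j].

Definition ract1 w f : Om1 := [ffun a => w a * Rtr a f].

Definition ract11 T f : Om11 := [ffun p => T p * Rtr p.1 (Rtr p.2 f)].

(* Total in [a] to avoid membership proofs; it is 0 for a outside C. *)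
Definition e (a : gT) : Om1 := [ffun c => (cls_val c == a)%:R].

(* (w_a e_a) (x) (v_b e_b) = w_a R_a(v_b) e_a (x) e_b *)
Definition tens w v : Om11 := [ffun p => w p.1 * Rtr p.1 (v p.2)].

Definition Psi T : Om11 :=
  \sum_(a : cls C) \sum_(b : cls C)
     lact (T (a, b)) (tens (e (Ad a b)) (e a)).

Definition ker_id_Psi : {pred Om11} := [pred T | T - Psi T == 0].

Lemma lactBl (J : finType) (u : {ffun J -> H}) f h :
  lact (f - h) u = lact f u - lact h u.
Proof. by apply/ffunP => j; rewrite !ffunE mulrBl. Qed.

Lemma PsiB : {morph Psi : T S / T - S}.
Proof.
move=> T S; rewrite /Psi -sumrB; apply: eq_bigr => a _.
by rewrite -sumrB; apply: eq_bigr => b _; rewrite -lactBl !ffunE.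
Qed.

Lemma ker_id_Psi_zmod : zmod_closed ker_id_Psi.
Proof.
split=> [|T S]; rewrite !inE !subr_eq0.
  by rewrite -{2}(subrr 0) PsiB subrr.
by move=> /eqP hT /eqP hS; rewrite PsiB -hT -hS.
Qed.
HB.instance Definition _ :=
  GRing.isZmodClosed.Build Om11 ker_id_Psi ker_id_Psi_zmod.

Definition Om2 : zmodType := Quotient.quot ker_id_Psi.

Definition wedge w v : Om2 := (\pi_(Quotient.quot ker_id_Psi) (tens w v))%qT.

Definition theta : Om1 := \sum_(a : cls C) e a.

Definition d_e (a : cls C) : Om2 := wedge theta (e a) + wedge (e a) theta.

Definition torsion_free (A : {ffun cls C -> Om1}) : Prop :=
  forall a : cls C,
    d_e a + \sum_(b : cls C)
              wedge (A b) (e ((b : gT)^-1 * (a : gT) * (b : gT))%g - e a) = 0.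

Lemma tens_balanced w v f : tens (ract1 w f) v = tens w (lact f v).
Proof. by apply/ffunP=> p; apply/ffunP=> g; rewrite !ffunE mulrA. Qed.

Lemma tens_bimodule f w v h :
  tens (lact f w) (ract1 v h) = lact f (ract11 (tens w v) h).
Proof. by apply/ffunP=> p; apply/ffunP=> g; rewrite !ffunE !mulrA. Qed.

Lemma e_eq (a c : cls C) : e a c = (c == a)%:R.
Proof. by rewrite ffunE. Qed.

Lemma e_basis w : w = \sum_(a : cls C) lact (w a) (e a).
Proof.
apply/ffunP=> c; rewrite sum_ffunE (bigD1 c) //= big1 => [|a nac].
  by rewrite ffunE e_eq eqxx mulr1 addr0.
by rewrite ffunE e_eq eq_sym (negPf nac) mulr0.
Qed.

Lemma RtrB a : {morph Rtr a : f h / f - h}.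
Proof. by move=> f h; apply/ffunP=> g; rewrite !ffunE. Qed.

Lemma Rtr_nat a n : Rtr a n%:R = n%:R.
Proof.
apply/ffunP=> g; rewrite ffunE; elim: n => [|n IH]; first by rewrite !ffunE.
by rewrite !mulrS [LHS]ffunE [RHS]ffunE IH !ffunE.
Qed.

Lemma tens_e (a b : gT) (p : cls C * cls C) :
  tens (e a) (e b) p = ((p.1 == a :> gT) && (p.2 == b :> gT))%:R.
Proof. by rewrite !ffunE Rtr_nat -natrM mulnb. Qed.

Lemma tens_basis T :
  T = \sum_(a : cls C) \sum_(b : cls C) lact (T (a, b)) (tens (e a) (e b)).
Proof.
rewrite pair_bigA /=; apply/ffunP=> -[p1 p2].
rewrite sum_ffunE (bigD1 (p1, p2)) //= big1 => [|[q1 q2] nqp] /=.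
  by rewrite ffunE tens_e !eqxx mulr1 addr0.
rewrite ffunE tens_e [_ && _](_ : _ = false) ?mulr0 //=.
by apply: contraNF nqp => /andP[/eqP/val_inj-> /eqP/val_inj->].
Qed.

Lemma tens_universal (M : zmodType) (phi : Om1 -> Om1 -> M) :
    (forall v, {morph phi^~ v : w w' / w - w'}) ->
    (forall w, {morph phi w : v v' / v - v'}) ->
    (forall w f v, phi (ract1 w f) v = phi w (lact f v)) ->
  exists2 phi' : {additive Om11 -> M}, forall w v, phi' (tens w v) = phi w v &
    forall psi : {additive Om11 -> M},
      (forall w v, psi (tens w v) = phi w v) -> psi =1 phi'.
Proof.
move=> phiBl phiBr phibal.
pose F T := \sum_(a : cls C) \sum_(b : cls C) phi (lact (T (a, b)) (e a)) (e b).
have FB : zmod_morphism F.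
  move=> T S; rewrite /F -sumrB; apply: eq_bigr => a _.
  by rewrite -sumrB; apply: eq_bigr => b _; rewrite -phiBl -lactBl !ffunE.
pose addF := GRing.isZmodMorphism.Build Om11 M F FB.
pose F' : {additive Om11 -> M} := HB.pack F addF.
pose phil v : {additive Om1 -> M} :=
  HB.pack (phi^~ v) (GRing.isZmodMorphism.Build Om1 M (phi^~ v) (phiBl v)).
pose phir w : {additive Om1 -> M} :=
  HB.pack (phi w) (GRing.isZmodMorphism.Build Om1 M (phi w) (phiBr w)).
exists F' => [w v|psi hpsi T].
  rewrite /= /F [in RHS](e_basis w) -[RHS]/(phil v _) raddf_sum.
  apply: eq_bigr => a _; rewrite /= [in RHS](e_basis v).
  rewrite -[RHS]/(phir _ _) raddf_sum; apply: eq_bigr => b _ /=.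
  rewrite -phibal; congr (phi _ _); apply/ffunP=> c.
  rewrite ffunE e_eq [RHS]ffunE [lact _ _ c]ffunE e_eq.
  case: eqP => [->|_]; last by rewrite !mulr0 mul0r.
  by rewrite !mulr1 ffunE.
rewrite /= /F {1}(tens_basis T) raddf_sum; apply: eq_bigr => a _.
rewrite raddf_sum; apply: eq_bigr => b _; rewrite -hpsi; congr (psi _).
by apply/ffunP=> p; apply/ffunP=> g; rewrite !ffunE mulrA.
Qed.

Lemma Psi_e (a b : cls C) : Psi (tens (e a) (e b)) = tens (e (Ad a b)) (e a).
Proof.
rewrite /Psi pair_bigA /= (bigD1 (a, b)) //= big1 => [|q nq].
  by rewrite tens_e !eqxx addr0; apply/ffunP=> p; rewrite ffunE mul1r.
rewrite tens_e [_ && _](_ : _ = false).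
  by apply/ffunP=> p; rewrite !ffunE mul0r.
by apply: contraNF nq => /andP[/eqP/val_inj <- /eqP/val_inj <-]; case: (q).
Qed.

Lemma Psi_lact f T : Psi (lact f T) = lact f (Psi T).
Proof.
apply/ffunP=> p; rewrite [RHS]ffunE !sum_ffunE mulr_sumr.
apply: eq_bigr => a _; rewrite !sum_ffunE mulr_sumr.
by apply: eq_bigr => b _; rewrite ffunE [lact f T _]ffunE [in RHS]ffunE mulrA.
Qed.

Lemma Psi_ract f T : Psi (ract11 T f) = ract11 (Psi T) f.
Proof.
apply/ffunP=> p; rewrite [RHS]ffunE !sum_ffunE mulr_suml.
apply: eq_bigr => a _; rewrite !sum_ffunE mulr_suml.
apply: eq_bigr => b _; rewrite ffunE [ract11 T _ _]ffunE [in RHS]ffunE tens_e.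
case: andP => [[/eqP h1 /eqP h2]|_]; last by rewrite !mulr0 mul0r.
rewrite !mulr1; congr (_ * _); apply/ffunP=> g; rewrite !ffunE /= h1 h2.
by rewrite /Ad -!mulgA mulVg mulg1.
Qed.

End Calculus.

Arguments e {K gT C} a.
Notation "f **: w" := (lact f w) (at level 40, left associativity) : ring_scope.

(* Main.v *)
(** Write A_b^p for the coefficient of e_p in A_b and S^p for the sum over b of
    A_b^p.  The torsion 2-form of A at a is the class of a tensor T_a with
    T_a(p, q) = [p = a] + [q = a] (1 - S^p) + A_b^p, where a = b q b^-1, and its
    class vanishes iff T_a is Psi-invariant, i.e. T_a(p, q) = T_a(q, r) whenever
    p = q r q^-1.  Take p <> q.  If a is none of p, q, r, this equates two
    coefficients of the connection, and a = p gives A_q^q = 1 + A_b^p.  These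
    relations leave four functions, and one instance with a = r then forces
    S = 0, which is also the condition alpha + beta + gamma + lambda = -1.
    Conversely, once S = 0 all the remaining invariance conditions hold by
    inspection of the table. *)
Require Import Defs.
From HB Require Import structures.
From mathcomp Require Import all_boot all_order all_algebra all_fingroup.
From mathcomp Require Import reals complex.
From mathcomp Require Import generic_quotient ring_quotient ring.

Set Implicit Arguments.
Unset Strict Implicit.
Unset Printing Implicit Defensive.
Import GRing.Theory.
Local Open Scope ring_scope.

(** Distributes evaluation over sums only, whereas [ffunE] would also unfold [tetra]. *)
Lemma ffunDE (I : finType) (W : zmodType) (f g : {ffun I -> W}) i :
  (f + g) i = f i + g i.
Proof. by rewrite ffunE. Qed.

(** * Torsion as an invariance condition on tensor coefficients *)

Section Torsion.
Variables (K : fieldType) (gT : finGroupType) (C : {set gT}).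
Implicit Types (a b p q r : cls C) (A : {ffun cls C -> Om1 K gT C}).

Definition torsion_rep A a : Om11 K gT C :=
  tens (theta K C) (e a) + tens (e a) (theta K C)
  + \sum_b tens (A b) (e (((b : gT)^-1 * (a : gT) * (b : gT))%g) - e a).

Definition torsion_coef A a p q : funalg K gT :=
  (q == a :> gT)%:R + (p == a :> gT)%:R
  + \sum_b A b p * ((Ad b q == a :> gT)%:R - (q == a :> gT)%:R).

(** Every right-hand factor in [torsion_rep] has constant coefficients, so the translations [Rtr]
    inside [tens] act trivially and the coefficients of [A] are never shifted: the torsion equations
    are pointwise on the group. *)
Lemma torsion_repE A a p q : torsion_rep A a (p, q) = torsion_coef A a p q.
Proof.
have thetaE c : theta K C c = 1.
  rewrite /theta sum_ffunE (bigD1 c) //= big1 ?addr0 => [|b nbc].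
    by rewrite e_eq eqxx.
  by rewrite e_eq eq_sym (negPf nbc).
have R1 c : Rtr c (1 : funalg K gT) = 1 by rewrite -[1]/(1%:R) Rtr_nat.
rewrite /torsion_rep ffunE [X in X + _]ffunE ![tens _ _ _]ffunE /=.
rewrite !thetaE !R1 !e_eq Rtr_nat sum_ffunE mul1r mulr1 /torsion_coef.
congr (_ + _); apply: eq_bigr => b _; rewrite !ffunE /= RtrB !Rtr_nat.
suff -> : (q == ((b : gT)^-1 * (a : gT) * (b : gT))%g :> gT)
    = (Ad b q == a :> gT) by [].
rewrite /Ad; apply/eqP/eqP => [->|<-].
  by rewrite !mulgA mulgV mul1g mulgK.
by rewrite !mulgA mulVg mul1g mulgKV.
Qed.

(** Conjugation by [q] is injective, so [(q, r)] is the only index contributing to the coefficient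
    at [(p, q)]. *)
Lemma PsiE (T : Om11 K gT C) p q r : Ad q r = p -> Psi T (p, q) = T (q, r).
Proof.
move=> qrp; rewrite {1}/Psi pair_bigA /= sum_ffunE (bigD1 (q, r)) //= big1.
  by rewrite addr0 ffunE tens_e /= qrp !eqxx mulr1.
move=> [a b] nab; rewrite ffunE tens_e /= [_ && _](_ : _ = false) ?mulr0 //.
apply: contraNF nab => /andP[/eqP pE /eqP/val_inj qE]; subst a.
move: qrp; rewrite pE /Ad => /mulIg/mulgI/val_inj->; exact: eqxx.
Qed.

(** Closure of the class under conjugation makes every index pair [(p, q)] fall under [PsiE]. *)
Lemma cls_conj (conjC : C \in classes [set: gT]) p q :
  exists r, Ad q r = p.
Proof.
have CJ u v : u \in C -> (u ^ v)%g \in C.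
  case/imsetP: conjC => w _ -> /imsetP[v' _ ->].
  by rewrite -conjgM memJ_class ?inE.
exists (Cls (CJ _ (cls_val q) (clsP p))).
by rewrite /Ad /= conjgE !mulgA mulgV mul1g mulgK.
Qed.

Lemma torsion_freeE (conjC : C \in classes [set: gT]) A :
  torsion_free A <->
  forall a p q r, Ad q r = p -> torsion_coef A a p q = torsion_coef A a q r.
Proof.
have repE a : reflect (Psi (torsion_rep A a) = torsion_rep A a)
    (d_e K a + \sum_b wedge (A b)
       (e (((b : gT)^-1 * (a : gT) * (b : gT))%g) - e a) == 0).
  rewrite /d_e /wedge -raddf_sum -!raddfD -/(torsion_rep A a).
  (* With 0 written as the class of 0, equality in the quotient becomes membership of the difference
     in the kernel of id - Psi. *)
  rewrite -(raddf0 (\pi_(Quotient.quot (@ker_id_Psi K gT C)))%qT).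
  rewrite -Quotient.idealrBE subr0 inE subr_eq0 eq_sym; exact: eqP.
split=> [hA a p q r qrp|hA a].
  rewrite -!torsion_repE -(PsiE _ qrp).
  by have /eqP/repE -> := hA a.
apply/eqP/repE/ffunP => -[p q]; have [r qrp] := cls_conj conjC p q.
by rewrite (PsiE _ qrp) !torsion_repE; apply/esym/hA.
Qed.

Lemma torsion_coefE A a p q :
  torsion_coef A a p q =
    (p == a :> gT)%:R + (q == a :> gT)%:R * (1 - (\sum_b A b) p)
    + \sum_b A b p * (Ad b q == a :> gT)%:R.
Proof.
rewrite /torsion_coef (eq_bigr _ (fun b _ => mulrBr _ _ _)) sumrB -mulr_suml.
rewrite sum_ffunE mulrBr mulr1.
rewrite (_ : (\sum_b A b p) * _ = (q == a :> gT)%:R * \sum_b A b p).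
  by rewrite (AC (2*2) ((2*(1*4))*3)).
by case: eqP => _; rewrite ?(mulr0, mul0r, mulr1, mul1r).
Qed.
End Torsion.

(** * Solving the equations for the four-element class *)

Section Tetrahedron.
Variables (K : fieldType) (gT : finGroupType) (C : {set gT}) (t x y z : cls C).
Hypothesis clsC : C \in classes [set: gT].
Hypothesis cardC : #|C| = 4%N.
Hypothesis labelC : C = [set cls_val t; cls_val x; cls_val y; cls_val z].
Hypothesis tableC : Ad_table t x y z.
Local Notation V := {ffun cls C -> Om1 K gT C}.
Implicit Types (A : V) (al be ga la : funalg K gT).

Lemma mem_label u :
  (u \in C) = (u \in [:: cls_val t; cls_val x; cls_val y; cls_val z]).
Proof. by have /setP/(_ u) := labelC; rewrite !inE -!orbA. Qed.

Lemma label_uniq : uniq [:: cls_val t; cls_val x; cls_val y; cls_val z].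
Proof. by apply/card_uniqP; rewrite -(eq_card mem_label) cardC. Qed.

Lemma label_ind (P : cls C -> Prop) :
  P t -> P x -> P y -> P z -> forall c, P c.
Proof.
move=> Pt Px Py Pz c; have := clsP c; rewrite mem_label !inE.
by case/or4P => /eqP/val_inj->.
Qed.

Lemma sum_label (W : nmodType) (F : cls C -> W) :
  \sum_c F c = F t + F x + F y + F z.
Proof.
have label_enum : perm_eq (index_enum (cls C)) [:: t; x; y; z].
  apply: uniq_perm; rewrite ?index_enum_uniq //.
    by have := label_uniq; rewrite -(map_inj_uniq val_inj).
  move=> c; rewrite mem_index_enum !inE.
  by elim/label_ind: c; rewrite eqxx ?orbT.
by rewrite (perm_big _ label_enum) !big_cons big_nil /= addr0 !addrA.
Qed.

Lemma label_neq :
  ((t == x :> gT) = false) * ((x == t :> gT) = false) *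
  ((t == y :> gT) = false) * ((y == t :> gT) = false) *
  ((t == z :> gT) = false) * ((z == t :> gT) = false) *
  ((x == y :> gT) = false) * ((y == x :> gT) = false) *
  ((x == z :> gT) = false) * ((z == x :> gT) = false) *
  ((y == z :> gT) = false) * ((z == y :> gT) = false).
Proof.
have := label_uniq; rewrite /= !inE !negb_or -!andbA.
case/and5P => /negPf tx /negPf ty /negPf tz /negPf xy.
case/and3P => /negPf xz /negPf yz _.
by do !split; rewrite // eq_sym.
Qed.

Lemma AdE :
  (Ad t t = t) * (Ad t x = z) * (Ad t y = x) * (Ad t z = y) *
  (Ad x t = y) * (Ad x x = x) * (Ad x y = z) * (Ad x z = t) *
  (Ad y t = z) * (Ad y x = t) * (Ad y y = y) * (Ad y z = x) *
  (Ad z t = x) * (Ad z x = y) * (Ad z y = t) * (Ad z z = z).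
Proof. by have [[? ? ? ?] [? ? ? ?] [? ? ? ?] [? ? ? ?]] := tableC. Qed.

Definition lincomb (a b c d : funalg K gT) : Om1 K gT C :=
  a **: e t + b **: e x + c **: e y + d **: e z.

Lemma lincombE a b c d :
  (lincomb a b c d t = a) * (lincomb a b c d x = b) *
  (lincomb a b c d y = c) * (lincomb a b c d z = d).
Proof.
by do !split; rewrite !ffunE !label_neq eqxx !mulr0 mulr1 ?addr0 ?add0r.
Qed.

Lemma lincombP (w : Om1 K gT C) a b c d :
  w t = a -> w x = b -> w y = c -> w z = d -> w = lincomb a b c d.
Proof.
by move=> wt wx wy wz; apply/ffunP; elim/label_ind; rewrite lincombE.
Qed.

(* The homogeneous part of the solution with parameters alpha, beta, gamma,
   lambda; the inhomogeneous part is the connection A_b = e_b, [frame]. *)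
Definition tetra
    (u : funalg K gT * funalg K gT * funalg K gT * funalg K gT) : V :=
  let: (al, be, ga, la) := u in
  [ffun b : cls C =>
     if b == t then lincomb al ga la be else
     if b == x then lincomb la be al ga else
     if b == y then lincomb be la ga al else lincomb ga al be la].

Lemma tetraE al be ga la (B := tetra (al, be, ga, la)) :
  (B t = lincomb al ga la be) * (B x = lincomb la be al ga) *
  (B y = lincomb be la ga al) * (B z = lincomb ga al be la).
Proof.
by do !split; rewrite !ffunE -!(inj_eq val_inj) /= !label_neq ?eqxx.
Qed.

Lemma tetra_is_linear : linear tetra.
Proof.
move=> k [[[al be] ga] la] [[[al' be'] ga'] la'].
have linV (A B : V) b c : (k *: A + B) b c = k *: A b c + B b c.
  by rewrite !ffunE.
apply/ffunP => b; apply/ffunP => c; rewrite linV.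
by elim/label_ind: b; elim/label_ind: c; rewrite !tetraE !lincombE.
Qed.
HB.instance Definition _ := GRing.isLinear.Build _ _ _ _ tetra tetra_is_linear.

Definition frame : V := [ffun b : cls C => e (cls_val b)].

Let simp := (mulr0, mulr1, mul0r, mul1r, addr0, add0r).

Lemma frame_tetraE al be ga la (B := frame + tetra (al, be, ga, la)) :
  (B t = lincomb (1 + al) ga la be) * (B x = lincomb la (1 + be) al ga) *
  (B y = lincomb be la (1 + ga) al) * (B z = lincomb ga al be (1 + la)).
Proof.
by do !split; apply: lincombP; rewrite !ffunDE tetraE lincombE ffunE e_eq
  -(inj_eq val_inj) /= ?eqxx ?label_neq ?add0r.
Qed.

(** Among the four forms, the coefficients of any fixed [e c] contain each parameter exactly once
    and a single 1, so they add up to 1 + (al + be + ga + la). *)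
Lemma frame_tetra_sum al be ga la :
  al + be + ga + la = -1 -> \sum_b (frame + tetra (al, be, ga, la)) b = 0.
Proof.
move=> S.
have -> : la = -1 - al - be - ga.
  by rewrite -S; apply/ffunP => g; rewrite !ffunE; ring.
apply/ffunP => c; rewrite sum_label [RHS]ffunE 3!ffunDE !frame_tetraE.
by elim/label_ind: c; rewrite !lincombE; apply/ffunP => g; rewrite !ffunE; ring.
Qed.

Lemma torsion_free_tetra A :
  torsion_free A <->
    exists al be ga la,
      al + be + ga + la = -1 /\ A = frame + tetra (al, be, ga, la).
Proof.
rewrite torsion_freeE //; split=> [hA|[al [be [ga [la [S ->]]]]] a p q r].
  have true1 : true%:R = 1 :> funalg K gT by [].
  pose rules := (torsion_coefE, sum_label, AdE, label_neq, eqxx, simp, true1).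
  (* [hA a p q r]: [a] is none of p, q, r in the first eight instances, then
     [a] = p in four, and [a] = r in the last. *)
  have := hA t x y z; rewrite !rules => /(_ erefl) zx_xy.
  have := hA t z x y; rewrite !rules => /(_ erefl) yz_zx.
  have := hA x z y t; rewrite !rules => /(_ erefl) tz_zy.
  have := hA x y t z; rewrite !rules => /(_ erefl) yt_zy.
  have := hA y z t x; rewrite !rules => /(_ erefl) xz_zt.
  have := hA y t x z; rewrite !rules => /(_ erefl) tx_zt.
  have := hA z x t y; rewrite !rules => /(_ erefl) xt_yx.
  have := hA z y x t; rewrite !rules => /(_ erefl) ty_yx.
  have := hA x x t y; rewrite !rules => /(_ erefl) tt_zx.
  have := hA y y x t; rewrite !rules => /(_ erefl) xx_zy.
  have := hA z z y t; rewrite !rules => /(_ erefl) yy_xz.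
  have := hA y y z x; rewrite !rules => /(_ erefl) zz_ty.
  have := hA x t y x; rewrite !rules => /(_ erefl) sum_y.
  (* The parameters are read off coefficients that carry no summand 1: three from [A z], and lambda
     from [A t]. *)
  exists (A z x), (A z y), (A z t), (A t y); split.
    (* After substitution [sum_y] reads 1 + alpha = (1 - S^y) + alpha, where S^y = lambda + alpha +
       (1 + gamma) + beta. *)
    move: sum_y; rewrite -tt_zx !ffunDE -zx_xy -yy_xz xz_zt => /addIr/eqP.
    rewrite eq_sym -subr_eq0 addrAC subrr sub0r oppr_eq0 => /eqP sum0.
    apply/eqP; rewrite -addr_eq0 -sum0; apply/eqP.
    by rewrite [RHS](AC (2*2*1) (2*5*4*1*3)).
  apply/ffunP; elim/label_ind; rewrite frame_tetraE; apply: lincombP;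
  by rewrite -?tt_zx -?xx_zy -?yy_xz -?zz_ty -?tx_zt ?tz_zy -?xt_yx -?ty_yx
    -?zx_xy ?xz_zt -?yt_zy ?yz_zx.
rewrite !torsion_coefE frame_tetra_sum // ![(0 : Om1 K gT C) _]ffunE subr0.
rewrite !sum_label !frame_tetraE.
(* The pair [q], [r] determines [p], which leaves 64 identities between coefficients. *)
elim/label_ind: q; elim/label_ind: r; rewrite !AdE => /val_inj <-;
by elim/label_ind: a; rewrite ?label_neq ?eqxx !lincombE ?simp.
Qed.

(** * Dimension of the space of solutions *)

Lemma torsion_free_dim : affine_of_dim (@torsion_free K gT C) (3 * #|gT|).
Proof.
pose H := funalg K gT.
(* Differences of admissible parameters have sum zero, so three functions determine the fourth. *)
pose iota (u : H * H * H) := (u, - (u.1.1 + u.1.2 + u.2)).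
have iota_lin : linear iota.
  move=> k [[a b] c] [[a' b'] c']; congr pair => /=.
  rewrite scalerN !scalerDr -opprD; congr (- _).
  by rewrite [RHS](AC (3*3) (1*4*(2*5)*(3*6))).
pose iotaL : {linear (H * H * H)%type -> (H * H * H * H)%type} :=
  HB.pack iota (GRing.isLinear.Build _ _ _ _ iota iota_lin).
pose f := linfun (tetra \o iotaL).
have fE u : f u = tetra (iota u) by rewrite lfunE.
have f_inj : injective f.
  (* The form at [z] displays the three free functions as its coefficients at [t], [x] and [y]. *)
  move=> [[a b] c] [[a' b'] c']; rewrite !fE => /ffunP/(_ z)/ffunP.
  rewrite /iota !tetraE => E.
  by move: (E t) (E x) (E y); rewrite !lincombE => -> -> ->.
(* The base point is the solution with alpha = beta = gamma = 0, which forces lambda = -1. *)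
exists (frame + tetra (0, 0, 0, -1)), (limg f); split.
  rewrite limg_dim_eq ?(eqP (introT lker0P f_inj)) ?capv0 // dimvf.
  (* Each factor [H] has dimension [#|gT|] over [K], one for each group element. *)
  rewrite -[LHS]/(#|gT| * 1 + #|gT| * 1 + #|gT| * 1)%N.
  by rewrite muln1 !mulSn mul0n addn0 addnA.
move=> v; rewrite torsion_free_tetra; split.
  move=> [al [be [ga [la [S ->]]]]].
  apply/memv_imgP; exists (al, be, ga); rewrite ?memvf // fE.
  rewrite opprD addrACA subrr add0r -raddfB; congr tetra.
  rewrite /iota /=; congr (_, _); first by rewrite -[RHS]subr0.
  by rewrite -[LHS]/(la - -1) -S opprD addrCA subrr addr0.
move=> /memv_imgP[[[al be] ga] _]; rewrite fE => /(canRL (subrK _)) ->.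
exists al, be, ga, (- (al + be + ga) - 1); split.
  by rewrite addrA subrr add0r.
rewrite addrCA -raddfD; congr (_ + tetra _).
by rewrite /iota; congr (_, _); rewrite -[RHS]addr0.
Qed.
End Tetrahedron.

Theorem proposition3p4 (R : realType) (gT : finGroupType) (C : {set gT})
    (t x y z : cls C)
    (cyclicC : cyclic_class C)
    (cardC : #|C| = 4%N)
    (labelC : C = [set cls_val t; cls_val x; cls_val y; cls_val z])
    (tableC : Ad_table t x y z) :
  [/\ affine_of_dim (@torsion_free R[i] gT C) (3 * #|gT|),
      (forall A : {ffun cls C -> Om1 R[i] gT C},
         torsion_free A <->
         exists alpha beta gamma lambda : funalg R[i] gT,
           [/\ alpha + beta + gamma + lambda = -1,
               A t = (1 + alpha) **: e t + gamma **: e x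
                     + lambda **: e y + beta **: e z,
               A x = lambda **: e t + (1 + beta) **: e x
                     + alpha **: e y + gamma **: e z,
               A y = beta **: e t + lambda **: e x
                     + (1 + gamma) **: e y + alpha **: e z &
               A z = gamma **: e t + alpha **: e x
                     + beta **: e y + (1 + lambda) **: e z]) &
      (forall A : {ffun cls C -> Om1 R[i] gT C},
         torsion_free A -> \sum_(a : cls C) A a = 0)].
Proof.
have [clsC _ _] := cyclicC.
have tetraP := torsion_free_tetra clsC cardC labelC tableC.
have BE := frame_tetraE cardC labelC.
split; first exact: torsion_free_dim clsC cardC labelC tableC.
  move=> A; rewrite tetraP; split=> -[al [be [ga [la]]]].
    by case=> S ->; exists al, be, ga, la; split=> //; rewrite BE.
  case=> S At Ax Ay Az; exists al, be, ga, la; split=> //.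
  by apply/ffunP; apply: (label_ind labelC);
    rewrite BE; [apply: At | apply: Ax | apply: Ay | apply: Az].
move=> A /tetraP[al [be [ga [la [S ->]]]]].
exact: (frame_tetra_sum cardC labelC).
Qed.
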